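(* Let $K$ be a field of characteristic different from $2$, and let $\varphi$ and $\psi$ be anisotropic quadratic forms over $K$ with $\dim\psi\geq 2$. Write $X=(X_1,\ldots,X_{\dim\psi})$ for algebraically independent variables over $K$, and regard $\psi(X)$ as an element of $K(X)$. Then the following assertions are equivalent: (1) $\varphi_{K(\psi)}$ is isotropic; (2) $D_F(\psi)D_F(\psi)\subset D_F(\varphi)D_F(\varphi)$ for every field extension $F/K$; (3) $a\psi(X)\in D_{K(X)}(\varphi)D_{K(X)}(\varphi)$ for every $a\in D_K(\psi)$; (4) $N_F(\psi)\subset N_F(\varphi)$ for every field extension $F/K$; (5) $a\psi(X)\in N_{K(X)}(\varphi)$ for every $a\in D_K(\psi)$; (6) $T_F(a\psi)\subset T_F(\varphi)$ for every field extension $F/K$ and every $a\in D_K(\psi)$; (7) $a\psi(X)\in T_{K(X)}(\varphi)$ for every $a\in D_K(\psi)$.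
   Context: All quadratic forms are finite-dimensional and nondegenerate, over fields of characteristic different from $2$. A form is isotropic if it represents $0$ nontrivially, anisotropic otherwise. For a form $\varphi$ over $K$ and a field extension $F/K$: $D_F(\varphi)$ is the set of nonzero elements of $F$ represented by $\varphi_F$; $D_F(\varphi)D_F(\varphi)=\{ab: a,b\in D_F(\varphi)\}$; $T_F(\varphi)$ is the subgroup of $F^\ast$ generated by $D_F(\varphi)$; $N_F(\varphi)$ is the subgroup of $F^\ast$ generated by $D_F(\varphi)D_F(\varphi)$. For $a\in K^\ast$, $a\psi$ is the form $v\mapsto a\psi(v)$. For a form $\psi\simeq\langle b_1,\ldots,b_n\rangle$ with $n\geq2$, its function field is $K(\psi)=K(X_2,\ldots,X_n)\bigl(\sqrt{-\tfrac{1}{b_1}(b_2X_2^2+\cdots+b_nX_n^2)}\bigr)$ (well defined up to $K$-isomorphism). *)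

(* Defs.v *)
From HB Require Import structures.
From Stdlib Require Import ClassicalEpsilon.
From mathcomp Require Import all_boot all_order all_algebra.
From mathcomp Require Import fraction qpoly qfpoly.
From mathcomp.multinomials Require Import mpoly.

Set Implicit Arguments.
Unset Strict Implicit.
Unset Printing Implicit Defensive.

Import GRing.Theory.
Local Open Scope ring_scope.

(* In characteristic different from 2, an n-dimensional quadratic form is given
   by its symmetric Gram matrix A, via v |-> v A v^T on row vectors; it is
   nondegenerate iff A is invertible. *)
Definition qeval (F : fieldType) (n : nat) (A : 'M[F]_n) (v : 'rV[F]_n) : F :=
  (v *m A *m v^T) 0 0.

Definition quadratic_form (F : fieldType) (n : nat) (A : 'M[F]_n) : Prop :=
  A^T = A /\ A \in unitmx.

Definition isotropic (F : fieldType) (n : nat) (A : 'M[F]_n) : Prop :=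
  exists v : 'rV[F]_n, v != 0 /\ qeval A v = 0.

Definition anisotropic (F : fieldType) (n : nat) (A : 'M[F]_n) : Prop :=
  ~ isotropic A.

Definition isometric (F : fieldType) (n : nat) (A B : 'M[F]_n) : Prop :=
  exists P : 'M[F]_n,
    P \in unitmx /\ forall v : 'rV[F]_n, qeval A v = qeval B (v *m P).

Record field_extension (K : fieldType) := FieldExtension {
  ext_field :> fieldType;
  ext_map : {rmorphism K -> ext_field}
}.

Definition base_change (K : fieldType) (F : field_extension K) (n : nat)
  (A : 'M[K]_n) : 'M[F]_n := map_mx (ext_map F) A.

Definition repr_set (F : fieldType) (n : nat) (A : 'M[F]_n) (x : F) : Prop :=
  x != 0 /\ exists v : 'rV[F]_n, qeval A v = x.

Definition repr_prod (F : fieldType) (n : nat) (A : 'M[F]_n) (x : F) : Prop :=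
  exists y z : F, [/\ repr_set A y, repr_set A z & x = y * z].

(* The subgroup of F^* generated by S, for S contained in F^*. *)
Inductive gen_subgroup (F : fieldType) (S : F -> Prop) : F -> Prop :=
| gen_subgroup_mem x : S x -> gen_subgroup S x
| gen_subgroup1 : gen_subgroup S 1
| gen_subgroupM x y :
    gen_subgroup S x -> gen_subgroup S y -> gen_subgroup S (x * y)
| gen_subgroupV x : gen_subgroup S x -> gen_subgroup S x^-1.

Definition T_group (F : fieldType) (n : nat) (A : 'M[F]_n) : F -> Prop :=
  gen_subgroup (repr_set A).

Definition N_group (F : fieldType) (n : nat) (A : 'M[F]_n) : F -> Prop :=
  gen_subgroup (repr_prod A).

Definition ratfun (K : fieldType) (n : nat) : field_extension K :=
  FieldExtension (@FracField.tofrac {mpoly K[n]} \o @mpolyC n K).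

Definition ratfun_X (K : fieldType) (n : nat) (i : 'I_n) : ratfun K n :=
  FracField.tofrac ('X_i : {mpoly K[n]}).

Definition generic_value (K : fieldType) (n : nat) (A : 'M[K]_n) :
  ratfun K n :=
  qeval (base_change (ratfun K n) A) (\row_i ratfun_X K i).

(* F(sqrt d): this is F[X]/(X^2 - d) when X^2 - d is irreducible. Otherwise d is
   already a square in F, and F(sqrt d) = F. *)
Definition sqrt_extension (F : fieldType) (d : F) : field_extension F :=
  match excluded_middle_informative (irreducible_poly ('X^2 - d%:P)) with
  | left irr =>
      let L := {poly %/ ('X^2 - d%:P) with (irr, monicXnsubC d (ltn0Sn 1))} in
      @FieldExtension F L (GRing.in_alg L)
  | right _ => @FieldExtension F F idfun
  end.

Definition comp_extension (K : fieldType) (F : field_extension K)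
  (L : field_extension F) : field_extension K :=
  FieldExtension (ext_map L \o ext_map F).

(* For <b_1, ..., b_n.+2>, the variables X_2, ..., X_n.+2 are indexed by
   'I_n.+1, so that the coefficient of X_(i.+2) is at position lift ord0 i. *)
Definition function_field_radicand (K : fieldType) (n : nat)
  (b : 'rV[K]_n.+2) : ratfun K n.+1 :=
  let c (i : 'I_n.+2) : ratfun K n.+1 := ext_map (ratfun K n.+1) (b 0 i) in
  - (c ord0)^-1 * \sum_(i < n.+1) c (lift ord0 i) * ratfun_X K i ^+ 2.

Definition function_field (K : fieldType) (n : nat) (b : 'rV[K]_n.+2) :
  field_extension K :=
  comp_extension (sqrt_extension (function_field_radicand b)).

Lemma sqrt_extensionP (F : fieldType) (d : F) :
  exists s : sqrt_extension d,
    s ^+ 2 = ext_map (sqrt_extension d) d /\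
    forall x, exists u v : F,
      x = ext_map (sqrt_extension d) u + ext_map (sqrt_extension d) v * s.
Proof.
have sz : size ('X^2 - d%:P) = 3%N by exact: size_XnsubC.
rewrite /sqrt_extension; case: excluded_middle_informative => [irr|nirr] /=.
  set hI := (irr, _).
  have hE : mk_monic ('X^2 - d%:P) = 'X^2 - d%:P := mk_monicE hI.
  exists (in_qpoly ('X^2 - d%:P) 'X); split.
    have qpp : in_qpoly ('X^2 - d%:P) ('X^2 - d%:P) = 0.
      by apply: val_inj; rewrite /= hE Pdiv.RingMonic.rmodpp ?monicXnsubC.
    rewrite -[LHS](rmorphXn (in_qpoly ('X^2 - d%:P)) 2 'X).
    rewrite -[LHS]subr0 -qpp -raddfB /= opprB addrCA subrr addr0.
    apply: val_inj; rewrite /= hE Pdiv.CommonRing.rmodp_small ?alg_polyC //.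
    by rewrite sz (leq_ltn_trans (size_polyC_leq1 _)).
  move=> x; pose y : {poly F} := (x : {poly %/ ('X^2 - d%:P)}).
  exists y`_0, y`_1.
  have szx : (size y <= 2)%N.
    have := @size_mk_monic _ ('X^2 - d%:P) x.
    by rewrite [X in (_ < X)%N](congr1 (fun q : {poly F} => size q) hE) sz.
  rewrite -[RHS]/((y`_0)%:A + (y`_1)%:A * in_qpoly ('X^2 - d%:P) 'X).
  rewrite -scalerAl mul1r; apply: val_inj; rewrite /= -/y.
  rewrite [in RHS]hE Pdiv.CommonRing.rmodp_small ?sz ?size_polyX //.
  apply/polyP => -[|[|i]]; rewrite !(coefD, coefZ, coefC, coefX) /=.
  - by rewrite mulr1 mulr0 addr0.
  - by rewrite mulr1 mulr0 add0r.
  - by rewrite !mulr0 addr0 nth_default // (leq_trans szx).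
case: (classic (exists x, root ('X^2 - d%:P) x)) => [[s]|nroot].
  rewrite /root !hornerE subr_eq0 => /eqP sd.
  by exists s; split=> [|x] //; exists x, 0; rewrite mul0r addr0.
case: nirr; apply: cubic_irreducible; first by rewrite sz.
by move=> x; apply/negP => rx; apply: nroot; exists x.
Qed.

Lemma isometric_diag (K : fieldType) (n : nat) (A : 'M[K]_n) :
  2%N \notin [pchar K] -> A^T = A ->
  exists b : 'rV[K]_n, isometric A (diag_mx b).
Proof.
move=> char2 symA.
have two0 : 2%:R != 0 :> K by move: char2; rewrite inE.
suff [P [b [uP PAP]]] : exists (P : 'M_n) (b : 'rV_n),
    P \in unitmx /\ P *m A *m P^T = diag_mx b.
  exists b, (invmx P); split=> [|v]; first by rewrite unitmx_inv.
  rewrite /qeval -PAP trmx_mul trmx_inv !mulmxA mulmxKV //.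
  by rewrite mulmxK ?unitmx_tr.
elim: n A symA => [|n IHn] A symA.
  by exists 1%:M, 0; rewrite unitmx1; split=> //; apply/matrixP => -[].
have [A0|nzA] := eqVneq A 0.
  by exists 1%:M, 0; rewrite unitmx1 A0 mulmx0 mul0mx linear0.
have [v qv] : exists v : 'rV_(1 + n), v *m A *m v^T != 0.
  apply: NNPP => nov.
  have q0 (v : 'rV_(1 + n)) : v *m A *m v^T = 0.
    by apply/eqP; apply: contraT => qv; case: nov; exists v.
  case/eqP: nzA; apply/matrixP => i j; rewrite mxE.
  pose ei : 'rV[K]_(1 + n) := delta_mx 0 i.
  pose ej : 'rV[K]_(1 + n) := delta_mx 0 j.
  have := q0 (ei + ej); rewrite linearD /= mulmxDl mulmxDl !mulmxDr !q0.
  rewrite add0r addr0.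
  have -> : ej *m A *m ei^T = (ei *m A *m ej^T)^T.
    by rewrite !trmx_mul trmxK symA mulmxA.
  move/(congr1 (fun M : 'M_1 => M 0 0)); rewrite !mxE -mulr2n -mulr_natl.
  move/eqP; rewrite mulf_eq0 (negPf two0) /= => /eqP <-.
  rewrite (bigD1 j) //= big1 ?addr0 => [|k kj].
    by rewrite -rowE !mxE !eqxx mulr1.
  by rewrite !mxE (negPf kj) andbF mulr0.
pose B : 'M_(1 + n) := row_ebase v *m A *m (row_ebase v)^T.
have symB : B^T = B by rewrite /B !trmx_mul trmxK symA mulmxA.
have rv : \rank v = 1%N.
  apply/eqP; rewrite eqn_leq rank_leq_row lt0n mxrank_eq0.
  by apply: contraNneq qv => ->; rewrite !mul0mx.
pose a := ulsubmx B 0 0.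
have aE : ulsubmx B = a%:M by rewrite /a -mx11_scalar.
have nza : a != 0.
  apply: contraNneq qv => a0; move: aE; rewrite a0 raddf0 => B0.
  rewrite -(mulmx_ebase v) rv !trmx_mul !mulmxA.
  have -> : forall (c : 'M_1) (p : 'M_(1, 1 + n)),
      c *m p *m row_ebase v *m A *m (row_ebase v)^T *m p^T *m c^T =
      c *m (p *m B *m p^T) *m c^T by move=> c p; rewrite /B !mulmxA.
  rewrite -[B]submxK B0 pid_mx_row tr_row_mx trmx0 mul_row_block.
  by rewrite mul_row_col trmx1 !mul1mx !mul0mx mulmx1 !mulmx0 !addr0
    mulmx0 mul0mx.
pose w := ursubmx B.
have wE : dlsubmx B = w^T by rewrite /w trmx_ursub symB.
pose E : 'M_(1 + n) := block_mx 1%:M 0 (- a^-1 *: w^T) 1%:M.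
pose D := drsubmx B - a^-1 *: (w^T *m w).
have symD : D^T = D.
  by rewrite /D linearB /= linearZ /= trmx_mul trmxK trmx_drsub symB.
have EBE : E *m B *m E^T = block_mx a%:M 0 0 D.
  rewrite -[B]submxK aE wE -/w /E tr_block_mx !mulmx_block.
  rewrite !trmx1 trmx0 linearZ /= trmxK !mul1mx !mulmx1 !mul0mx !mulmx0 !addr0.
  rewrite -!scalemxAr -!scalemxAl !mul_scalar_mx mul_mx_scalar !scalerA.
  rewrite mulNr mulVf // !scaleN1r !addNr mul0mx scaler0 add0r.
  by rewrite scaleNr [- _ + _]addrC.
have [P [b [uP PDP]]] := IHn D symD.
pose Q : 'M_(1 + n) := block_mx 1%:M 0 0 P.
have uE : E \in unitmx by rewrite unitmxE det_lblock !det1 mulr1 unitr1.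
have uQ : Q \in unitmx by rewrite block_diag_mx_unit unitmx1 uP.
exists (Q *m E *m row_ebase v), (row_mx a%:M b); split.
  by rewrite !unitmx_mul uE row_ebase_unit uQ.
transitivity (Q *m (E *m B *m E^T) *m Q^T).
  by rewrite /B !trmx_mul !mulmxA.
rewrite [RHS](diag_mx_row (a%:M : 'rV_1) b) EBE /Q tr_block_mx !trmx0 trmx1.
rewrite !mulmx_block !mul0mx !mulmx0 !mul1mx !mulmx1 !addr0 !add0r.
have -> : diag_mx (a%:M : 'rV_1) = a%:M.
  by apply/matrixP => i j; rewrite !ord1 !mxE.
by rewrite PDP mul0mx.
Qed.

(* Main.v *)
(* Every condition is equivalent to: phi is isotropic over each extension L/K
   over which psi is isotropic. The bridge between K(X) and L is substitution of
   a curve X := g(t) with g(0) a prescribed point of L^n, chosen so that a given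
   nonzero polynomial over K does not vanish on it.
   - An isotropic vector of phi over K(psi) yields, along a curve through an
     isotropic vector of psi_L, a vector over L[t]; dividing it by the largest
     possible power of t and setting t = 0 gives an isotropic vector over L.
   - If phi_L is anisotropic, then its values on L[t] have even order at t = 0.
     A curve through an isotropic vector of psi_L, with tangent not orthogonal
     to it, gives psi(X) order 1, so a psi(X) is not a product of values of phi.
   - To get (2), restrict psi to the plane spanned by two vectors; it becomes
     isotropic over a quadratic extension, so phi contains a similar form. *)
From Stdlib Require Import Classical.
Require Import Defs.
From mathcomp Require Import all_boot all_order all_algebra.
From mathcomp Require Import fraction.
From mathcomp.multinomials Require Import mpoly.
From mathcomp Require Import ring.

Set Implicit Arguments.
Unset Strict Implicit.
Unset Printing Implicit Defensive.

Import GRing.Theory.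
Local Open Scope ring_scope.

(** * Points where a nonzero polynomial does not vanish *)

Lemma poly_nonroot_seq (S : idomainType) (q : {poly S}) (a : nat -> S) :
  injective a -> q != 0 -> exists k, q.[a k] != 0.
Proof.
move=> a_inj q0.
have [/allP roots|/allPn[x /mapP[k _ ->] ak]] :=
  boolP (all (root q) (mkseq a (size q))); last by exists k.
have := max_poly_roots q0 (introT allP roots) (mkseq_uniq _ a_inj).
by rewrite size_mkseq ltnn.
Qed.

(** A monomial is determined by its exponents in the first [n] variables together with its last
    exponent, so each coefficient of [p] reappears as a single coefficient of [muni p]. *)
Lemma muni_eq0 (n : nat) (R : nzRingType) (p : {mpoly R[n.+1]}) :
  (muni p == 0) = (p == 0).
Proof.
apply/eqP/eqP => [p0|->]; last exact: muni0.
apply/mpolyP => m; rewrite mcoeff0.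
pose w (m : 'X_{1..n.+1}) := [multinom m (widen_ord (leqnSn n) i) | i < n].
have w_inj (m' : 'X_{1..n.+1}) :
    w m' = w m -> m' ord_max = m ord_max -> m' = m.
  move=> /mnmP ww mm; apply/mnmP => i; have [->//|i_lt] := eqVneq i ord_max.
  have lt_in : (i < n)%N by rewrite ltn_neqAle i_lt -ltnS ltn_ord.
  have -> : i = widen_ord (leqnSn n) (Ordinal lt_in) by apply: val_inj.
  by have := ww (Ordinal lt_in); rewrite !mnmE.
have := congr1 (fun q : {poly {mpoly R[n]}} => q`_(m ord_max)@_(w m)) p0.
rewrite coef0 mcoeff0 muniE coef_sum raddf_sum /= => p0m.
rewrite -[RHS]p0m [p in LHS]mpolyE raddf_sum /=; apply: eq_bigr => m' _.
rewrite mcoeffZ mcoeffX coefZ coefXn -/(w m') eq_sym.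
have [->|m'_neq] := eqVneq m m'.
  by rewrite !eqxx !mulr1 mcoeffZ mcoeffX eqxx mulr1.
have [mm|_] := eqVneq (m ord_max) (m' ord_max); last by rewrite !mulr0 mcoeff0.
rewrite mulr1 mcoeffZ mcoeffX.
by case: eqP => // ww; rewrite (w_inj m') ?eqxx in m'_neq.
Qed.

Lemma mmap_muni (n : nat) (R : nzRingType) (S : comNzRingType)
    (f : {rmorphism R -> S}) (h : 'I_n.+1 -> S) (p : {mpoly R[n.+1]}) :
  mmap f h p =
  (map_poly (mmap f (fun i => h (widen_ord (leqnSn n) i))) (muni p)).[
    h ord_max].
Proof.
rewrite muniE raddf_sum horner_sum; apply: eq_bigr => m _.
rewrite -mul_polyC -[_ *: 'X_[_]]mul_mpolyC /= [map_poly _ _]rmorphM hornerM /=.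
rewrite map_polyC /= map_polyXn hornerC hornerXn rmorphM /= mmapC mmapX.
rewrite /mmap1 big_ord_recr /= mulrA; congr (_ * _ * _).
by apply: eq_bigr => i _; rewrite mnmE.
Qed.

(** Induction on the number of variables: the first coordinates are chosen so that the leading
    coefficient in the last variable survives, and the resulting univariate polynomial has finitely
    many roots. The points lie in [S], because the coefficients may form a finite field. *)
Lemma mpoly_nonzero_on_grid (n : nat) (R : nzRingType) (S : idomainType)
    (f : {rmorphism R -> S}) (p : {mpoly R[n]}) (a : 'I_n -> nat -> S) :
  injective f -> (forall i, injective (a i)) -> p != 0 ->
  exists k : 'I_n -> nat, mmap f (fun i => a i (k i)) p != 0.
Proof.
move=> f_inj; elim: n p a => [|n IHn] p a a_inj p0.
  exists (fun=> 0%N); move: p0; rewrite [p]nvar0_mpolyC mmapC mpolyC_eq0.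
  by rewrite -(rmorph0 f) (inj_eq f_inj).
pose w (i : 'I_n) := widen_ord (leqnSn n) i.
have := p0; rewrite -muni_eq0 -lead_coef_eq0.
move=> /(IHn _ (fun i => a (w i)) (fun i => a_inj (w i)))[k lk].
set g := mmap _ _ in lk.
have : map_poly g (muni p) != 0.
  apply: contraNneq lk => /(congr1 (fun q : {poly S} => q`_(size (muni p)).-1)).
  by rewrite coef_map coef0 => /eqP.
move=> /(poly_nonroot_seq (a_inj ord_max))[l lP].
exists (fun i => if unlift ord_max i is Some j then k j else l).
rewrite mmap_muni unlift_none.
move: lP; congr (_.[_] != 0); apply: eq_map_poly => q.
apply: eq_bigr => m _; congr (_ * _); apply: mmap1_eq => i.
suff iE : widen_ord (leqnSn n) i = lift ord_max i by rewrite /w iE liftK.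
by apply: val_inj; rewrite /= /bump leqNgt ltn_ord.
Qed.

(** * Bilinear forms, values and isotropy *)

(** Defined over a commutative ring, unlike [qeval], since forms are also evaluated on vectors over
    [{mpoly K[n]}] and [{poly L}]. *)
Definition bilin (R : comNzRingType) (n : nat) (A : 'M[R]_n) (u v : 'rV[R]_n)
  : R := (u *m A *m v^T) 0 0.

Section Bilin.
Variables (R : comNzRingType) (n : nat) (A : 'M[R]_n).
Implicit Types u v w : 'rV[R]_n.

Lemma bilinDl u v w : bilin A (u + v) w = bilin A u w + bilin A v w.
Proof. by rewrite /bilin !mulmxDl mxE. Qed.

Lemma bilinDr u v w : bilin A u (v + w) = bilin A u v + bilin A u w.
Proof. by rewrite /bilin linearD mulmxDr mxE. Qed.

Lemma bilinZl a u v : bilin A (a *: u) v = a * bilin A u v.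
Proof. by rewrite /bilin -!scalemxAl mxE. Qed.

Lemma bilinZr a u v : bilin A u (a *: v) = a * bilin A u v.
Proof. by rewrite /bilin linearZ -scalemxAr mxE. Qed.

Lemma bilinC u v : A^T = A -> bilin A u v = bilin A v u.
Proof.
move=> symA; rewrite /bilin -[in RHS](trmxK (v *m A *m u^T)) [RHS]mxE.
by rewrite !trmx_mul trmxK symA mulmxA.
Qed.

Lemma bilin_delta u i : bilin A u (delta_mx 0 i) = (u *m A) 0 i.
Proof. by rewrite /bilin trmx_delta -colE mxE. Qed.

Lemma bilin0l u : bilin A 0 u = 0.
Proof. by rewrite /bilin !mul0mx mxE. Qed.

Lemma bilin_map (S : comNzRingType) (f : {rmorphism R -> S}) u v :
  bilin (map_mx f A) (map_mx f u) (map_mx f v) = f (bilin A u v).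
Proof. by rewrite /bilin map_trmx -!map_mxM mxE. Qed.

End Bilin.

Definition bilinE := (bilinDl, bilinDr, bilinZl, bilinZr).

Lemma qevalE (F : fieldType) (n : nat) (A : 'M[F]_n) (v : 'rV[F]_n) :
  qeval A v = bilin A v v.
Proof. by []. Qed.

Lemma qevalZ (F : fieldType) (n : nat) (A : 'M[F]_n) a (v : 'rV[F]_n) :
  qeval A (a *: v) = a ^+ 2 * qeval A v.
Proof. by rewrite !qevalE !bilinE; ring. Qed.

Lemma qevalD (F : fieldType) (n : nat) (A : 'M[F]_n) (u v : 'rV[F]_n) :
  A^T = A -> qeval A (u + v) = qeval A u + qeval A v + 2 * bilin A u v.
Proof.
by move=> symA; rewrite !qevalE !bilinE (bilinC v u symA); ring.
Qed.

Lemma anisotropic_qeval_eq0 (F : fieldType) (n : nat) (A : 'M[F]_n) v :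
  anisotropic A -> qeval A v = 0 -> v = 0.
Proof.
move=> anisoA qv; apply/eqP; apply: contraT => v0.
by case: anisoA; exists v.
Qed.

Lemma qform_bilin_neq0 (F : fieldType) (n : nat) (A : 'M[F]_n) (v : 'rV[F]_n) :
  quadratic_form A -> v != 0 -> exists i, bilin A v (delta_mx 0 i) != 0.
Proof.
move=> [_ uA] v0; have /rV0Pn[i vi] : v *m A != 0.
  by apply: contraNneq v0 => vA; rewrite -(mulmxK uA v) vA mul0mx.
by exists i; rewrite bilin_delta.
Qed.

(** For an isotropic [v] and some [e] not orthogonal to it, the value at [a *: v + e] is affine in
    [a] with nonzero slope [2 * bilin A v e]. *)
Lemma isotropic_universal (F : fieldType) (n : nat) (A : 'M[F]_n) (x : F) :
  2 != 0 :> F -> quadratic_form A -> isotropic A -> x != 0 -> repr_set A x.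
Proof.
move=> two0 qA [v [v0 qv]] x0; split=> //.
have [i bi] := qform_bilin_neq0 qA v0; set e := delta_mx 0 i in bi.
have symA := qA.1.
pose a := (x - qeval A e) / (2 * bilin A v e).
exists (a *: v + e); rewrite qevalD // qevalZ qv bilinE /a.
by field; rewrite bi two0.
Qed.

(** * Extension of scalars and quadratic extensions *)

Lemma map_quadratic_form (F : fieldType) (n : nat) (A : 'M[F]_n)
  (E : fieldType) (f : {rmorphism F -> E}) :
  quadratic_form A -> quadratic_form (map_mx f A).
Proof. by move=> [symA uA]; split; rewrite ?map_unitmx // map_trmx symA. Qed.

Lemma base_change_comp (K : fieldType) (F : field_extension K)
    (L : field_extension F) (n : nat) (A : 'M[K]_n) :
  base_change (comp_extension L) A = base_change L (base_change F A).
Proof. exact: map_mx_comp. Qed.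

Lemma bilin_base_change (K : fieldType) (F : field_extension K) (n : nat)
    (A : 'M[K]_n) u v :
  bilin (base_change F A) (map_mx (ext_map F) u) (map_mx (ext_map F) v) =
  ext_map F (bilin A u v).
Proof. exact: bilin_map. Qed.

Lemma qeval_base_change (K : fieldType) (F : field_extension K) (n : nat)
    (A : 'M[K]_n) v :
  qeval (base_change F A) (map_mx (ext_map F) v) = ext_map F (qeval A v).
Proof. exact: bilin_map. Qed.

(* The two equations say that [w1 + w2 sqrt d] is isotropic. *)
Lemma isotropic_sqrt_extension (F : fieldType) (d : F) (n : nat) (A : 'M[F]_n) :
  2 != 0 :> F -> A^T = A -> isotropic (base_change (sqrt_extension d) A) ->
  exists w1 w2, [/\ row_mx w1 w2 != 0, qeval A w1 + d * qeval A w2 = 0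
    & bilin A w1 w2 = 0].
Proof.
move=> two0 symA [v [v0 qv]]; have [s [s2 sP]] := sqrt_extensionP d.
move: s2 sP v v0 qv; move: (sqrt_extension d) s => L s s2 sP v v0 qv.
pose f := ext_map L; rewrite -/f in s2 sP.
have [vu vuP] := fin_all_exists (fun i => sP (v 0 i)).
have [vw vwP] := fin_all_exists vuP.
pose u := \row_i vu i; pose w := \row_i vw i.
have vE : v = map_mx f u + s *: map_mx f w.
  by apply/rowP => i; rewrite vwP !mxE mulrC.
have uw0 : row_mx u w != 0.
  apply: contraNneq v0 => /eqP; rewrite row_mx_eq0 => /andP[/eqP u0 /eqP w0].
  by rewrite vE u0 w0 !map_mx0 scaler0 addr0.
have symL : (base_change L A)^T = base_change L A.
  by rewrite /base_change map_trmx symA.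
move: qv; rewrite vE qevalD // qevalZ s2 !qeval_base_change bilinZr.
rewrite bilin_base_change -/f => qv.
have qv' : f (qeval A u + d * qeval A w) = - (s * f (2 * bilin A u w)).
  apply/eqP; rewrite -addr_eq0 -[X in _ == X]qv; apply/eqP.
  by rewrite rmorphD !rmorphM rmorph_nat /=; ring.
have [buw|buw] := eqVneq (bilin A u w) 0.
  exists u, w; split=> //; apply: (fmorph_inj f).
  by rewrite qv' buw mulr0 !rmorph0 mulr0 oppr0.
(* Here the isotropy equation can be solved for [s], which therefore lies in [F]. Then [v] is itself
   defined over [F], and [w2 = 0] will do. *)
pose t := - (qeval A u + d * qeval A w) / (2 * bilin A u w).
have st : s = f t.
  have b0 : f (2 * bilin A u w) != 0 by rewrite fmorph_eq0 mulf_neq0.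
  apply: (mulIf b0); rewrite -rmorphM /t mulfVK ?mulf_neq0 //.
  by rewrite rmorphN qv' opprK.
have vE' : v = map_mx f (u + t *: w) by rewrite vE map_mxD map_mxZ st.
exists (u + t *: w), 0; split.
- by rewrite row_mx_eq0 eqxx andbT -(map_mx_eq0 f) -vE'.
- rewrite qevalE [qeval A 0]bilin0l mulr0 addr0.
  apply: (fmorph_inj f); rewrite -qeval_base_change -vE' rmorph0.
  rewrite vE qevalD // qevalZ s2 !qeval_base_change bilinZr.
  by rewrite bilin_base_change.
- by rewrite /bilin trmx0 mulmx0 mxE.
Qed.

(* If [x = B(u) B(v)], with [w] the component of [v] orthogonal to [u], then
   [B] becomes isotropic over [F(sqrt (- B(w) / B(u)))]. *)
Lemma repr_prod_binary (F : fieldType) (m n : nat) (A : 'M[F]_m) (B : 'M[F]_n) :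
  2 != 0 :> F -> quadratic_form A -> (0 < m)%N -> B^T = B ->
  (forall d : F, isotropic (base_change (sqrt_extension d) B) ->
     isotropic (base_change (sqrt_extension d) A)) ->
  forall x, repr_prod B x -> repr_prod A x.
Proof.
move=> two0 qA m0 symB iso _ [y [z [[y0 [u yE]] [z0 [v zE]] ->]]].
have symA := qA.1.
case: (classic (isotropic A)) => [isoA|anisoA].
  by exists y, z; split=> //; apply: isotropic_universal.
pose k := bilin B u v; pose w := v - (k / y) *: u.
have buw : bilin B u w = 0.
  by rewrite /w -scaleNr !bilinE -qevalE yE -/k; field.
have qw : qeval B w = z - k ^+ 2 / y.
  rewrite /w -scaleNr qevalD // qevalZ bilinZr yE zE bilinC // -/k.
  by field.
(* If the Gram determinant [y * z - k ^+ 2] of [u] and [v] vanishes, the product is a square, and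
   [c * (k ^+ 2 / c)] is a factorization for any nonzero value [c] of [A]. *)
have [w0|w0] := eqVneq (qeval B w) 0.
  have yz : y * z = k ^+ 2.
    by move/eqP: qw; rewrite w0 eq_sym subr_eq0 => /eqP->; field.
  have k0 : k != 0.
    by apply/eqP => k0; have := mulf_neq0 y0 z0; rewrite yz k0 expr0n eqxx.
  pose e : 'rV[F]_m := const_mx 1.
  have c0 : qeval A e != 0.
    apply/eqP => /(anisotropic_qeval_eq0 anisoA) /rowP/(_ (Ordinal m0)).
    by rewrite !mxE => /eqP; rewrite oner_eq0.
  exists (qeval A e), (k ^+ 2 / qeval A e); split.
  - by split=> //; exists e.
  - split; first by rewrite mulf_neq0 ?invr_eq0 // expf_neq0.
    by exists ((k / qeval A e) *: e); rewrite qevalZ; field.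
  - by rewrite yz; field.
have isoB : isotropic (base_change (sqrt_extension (- qeval B w / y)) B).
  set d := - _ / y; have [s [s2 _]] := sqrt_extensionP d.
  move: s2; move: (sqrt_extension d) s => L s s2.
  have symL : (base_change L B)^T = base_change L B.
    by rewrite /base_change map_trmx symB.
  pose f := ext_map L; rewrite -/f in s2.
  (* This vector is nonzero because its product with [u] is [s] times [y], and [s ^+ 2 = d] is
     nonzero. *)
  exists (s *: map_mx f u + map_mx f w); split.
    apply/eqP => /(congr1 (fun t => bilin (base_change L B) t (map_mx f u))).
    rewrite bilin0l !bilinE (bilinC (map_mx f w)) // !bilin_base_change.
    rewrite buw -qevalE yE rmorph0 addr0 => /(congr1 (fun t => t ^+ 2)).
    rewrite exprMn s2 expr0n => /eqP /=.
    by rewrite -rmorphXn -rmorphM fmorph_eq0 !mulf_eq0 invr_eq0 oppr_eq0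
      (negPf w0) (negPf y0).
  rewrite qevalD // qevalZ s2 !qeval_base_change bilinZl bilin_base_change.
  rewrite buw rmorph0 !mulr0 addr0 -/f yE -rmorphM -rmorphD /d mulfVK //.
  by rewrite addNr rmorph0.
have [w1 [w2 [w120 q12 b12]]] :=
  isotropic_sqrt_extension two0 symA (iso _ isoB).
have c0 : qeval A w2 != 0.
  apply: contraNneq w120 => q2; rewrite row_mx_eq0.
  rewrite (anisotropic_qeval_eq0 anisoA q2) eqxx andbT.
  by apply/eqP/(anisotropic_qeval_eq0 anisoA); rewrite -q12 q2 mulr0 addr0.
have q1 : qeval A w1 = (qeval B w / y) * qeval A w2.
  by apply/eqP; rewrite -subr_eq0 -q12 !mulNr.
exists (qeval A w2), (y * z / qeval A w2); split.
- by split=> //; exists w2.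
- split; first by rewrite !mulf_neq0 ?invr_eq0.
  (* With [c = qeval A w2], the Gram matrix of [w2], [w1] is [c / y] times that of [u], [w]. Since
     [v] is [(k / y) *: u + w], its counterpart [(k / y) *: w2 + w1] has value [c * z / y]. *)
  exists ((y / qeval A w2) *: ((k / y) *: w2 + w1)).
  rewrite qevalZ qevalD // qevalZ bilinZl (bilinC w2) // b12 q1 qw.
  by field; rewrite c0 y0.
- by field.
Qed.

(** * Clearing denominators in fraction fields *)

Lemma fraction_numden (R : idomainType) (x : {fraction R}) :
  exists a b : R, b != 0 /\ FracField.tofrac b * x = FracField.tofrac a.
Proof.
elim/quotW: x => r; exists (\n_r), (\d_r); split; first exact: denom_ratioP.
rewrite !piE; apply/eqmodP => /=.
by rewrite FracField.equivfE /= !numden_Ratio ?mulf_neq0 ?oner_neq0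
  ?denom_ratioP // !mul1r mulr1 mulrC.
Qed.

Lemma clear_denominators (R : idomainType) (m : nat)
    (v : 'rV[{fraction R}]_m) :
  exists q (p : 'rV[R]_m),
    q != 0 /\ FracField.tofrac q *: v = map_mx (@FracField.tofrac R) p.
Proof.
have [a /fin_all_exists[b abP]] :=
  fin_all_exists (fun i => fraction_numden (v 0 i)).
exists (\prod_i b i), (\row_i (a i * \prod_(j | j != i) b j)); split.
  by apply/prodf_neq0 => i _; case: (abP i).
apply/rowP => i; rewrite !mxE (bigD1 i) //= !rmorphM /= -(abP i).2.
by rewrite mulrAC.
Qed.

Lemma tofrac_bilin (R : idomainType) (m : nat) (A : 'M[R]_m) (q : R)
    (u v : 'rV[{fraction R}]_m) (u' v' : 'rV[R]_m) :
  FracField.tofrac q *: u = map_mx (@FracField.tofrac R) u' ->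
  FracField.tofrac q *: v = map_mx (@FracField.tofrac R) v' ->
  FracField.tofrac (bilin A u' v') =
  FracField.tofrac q ^+ 2 * bilin (map_mx (@FracField.tofrac R) A) u v.
Proof. by move=> uE vE; rewrite -bilin_map -uE -vE bilinZl bilinZr mulrA. Qed.

(** Both equations are homogeneous of degree 2 in the pair of vectors, so they survive
    multiplication by a common denominator. *)
Lemma clear_denominators_isotropic (R : idomainType) (m : nat) (A : 'M[R]_m)
    (d : R) (v1 v2 : 'rV[{fraction R}]_m) :
  let A' := map_mx (@FracField.tofrac R) A in
  row_mx v1 v2 != 0 ->
  bilin A' v1 v1 + FracField.tofrac d * bilin A' v2 v2 = 0 ->
  bilin A' v1 v2 = 0 ->
  exists w1 w2 : 'rV[R]_m, [/\ row_mx w1 w2 != 0,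
    bilin A w1 w1 + d * bilin A w2 w2 = 0 & bilin A w1 w2 = 0].
Proof.
move=> A' v0 qv bv; have [q [w [q0 wE]]] := clear_denominators (row_mx v1 v2).
have tq0 : FracField.tofrac q != 0 by rewrite tofrac_eq0.
have [w1E w2E] :
    FracField.tofrac q *: v1 = map_mx (@FracField.tofrac _) (lsubmx w) /\
    FracField.tofrac q *: v2 = map_mx (@FracField.tofrac _) (rsubmx w).
  by apply: eq_row_mx; rewrite -scale_row_mx wE -map_row_mx hsubmxK.
exists (lsubmx w), (rsubmx w); split.
- apply: contraNneq v0; rewrite hsubmxK => w0.
  by move/eqP: wE; rewrite w0 map_mx0 scaler_eq0 (negPf tq0).
- apply/eqP; rewrite -tofrac_eq0 rmorphD rmorphM /=.
  rewrite (tofrac_bilin A w1E w1E) (tofrac_bilin A w2E w2E) mulrCA -mulrDr.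
  by rewrite qv mulr0.
- by apply/eqP; rewrite -tofrac_eq0 (tofrac_bilin A w1E w2E) bv mulr0.
Qed.

Lemma base_change_ratfun (K : fieldType) (N m : nat) (A : 'M[K]_m) :
  base_change (ratfun K N) A =
  map_mx (@FracField.tofrac {mpoly K[N]}) (map_mx (@mpolyC N K) A).
Proof. exact: map_mx_comp. Qed.

(** * Specialization along curves *)

(** Induction on a bound for the size of one nonzero entry, which drops each time a common factor
    ['X] is removed. *)
Lemma polyX_factor_row (F : fieldType) (m : nat) (w : 'rV[{poly F}]_m) :
  w != 0 -> exists k w', w = 'X^k *: w' /\ map_mx (horner_eval 0) w' != 0.
Proof.
move=> /rV0Pn[i].
have [s] := ubnP (size (w 0 i)); elim: s w => // s IHs w ws wi.
have [w0|w0] := eqVneq (map_mx (horner_eval 0) w) 0; last first.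
  by exists 0%N, w; rewrite expr0 scale1r.
have dX j : exists p, w 0 j = p * 'X.
  have /factor_theorem[p] : root (w 0 j) 0.
    by have /rowP/(_ j)/eqP := w0; rewrite !mxE.
  by rewrite subr0; exists p.
have [p pP] := fin_all_exists dX.
have pi : p i != 0 by apply: contraNneq wi => p0; rewrite pP p0 mul0r.
have [||k [w' [w'E w'0]]] := IHs (\row_j p j).
- by move: ws; rewrite mxE pP size_mulX.
- by rewrite mxE.
exists k.+1, w'; split=> //; apply/rowP => j.
by have /rowP/(_ j) := w'E; rewrite pP !mxE => ->; rewrite exprSr mulrAC.
Qed.

Lemma rmorph_mmap (n : nat) (R : nzRingType) (S S' : comNzRingType)
    (f : {rmorphism R -> S}) (g : {rmorphism S -> S'}) (h : 'I_n -> S) p :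
  g (mmap f h p) = mmap (g \o f) (g \o h) p.
Proof.
rewrite /mmap rmorph_sum; apply: eq_bigr => m _.
rewrite rmorphM /= rmorph_prod; congr (_ * _).
by apply: eq_bigr => i _; rewrite rmorphXn.
Qed.

Lemma row_mx_eq_scale (R : nzRingType) (m : nat) (a : R) (w1 w2 : 'rV[R]_m)
    (w : 'rV[R]_(m + m)) :
  row_mx w1 w2 = a *: w ->
  w1 = a *: lsubmx w /\ w2 = a *: rsubmx w.
Proof. by rewrite -{1}[w]hsubmxK scale_row_mx => /eq_row_mx. Qed.

(** The curve passes through [c] at 0 with tangent [y]. Its higher-order terms remain free: letting
    them run through powers of ['X] gives infinitely many choices per coordinate, even when [L] is
    finite. *)
Lemma mmap_poly_curve (n : nat) (K L : fieldType) (f : {rmorphism K -> L})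
    (c y : 'I_n -> L) (p : {mpoly K[n]}) :
  p != 0 -> exists z : 'I_n -> {poly L},
    mmap (polyC \o f) (fun i => (c i)%:P + 'X * ((y i)%:P + 'X * z i)) p != 0.
Proof.
move=> p0.
pose a i k : {poly L} := (c i)%:P + 'X * ((y i)%:P + 'X * 'X^k).
have [|i k l|k kP] := @mpoly_nonzero_on_grid _ _ _ (polyC \o f) p a _ _ p0.
- exact: (inj_comp polyC_inj (fmorph_inj f)).
- move/addrI/(mulfI (negbT (polyX_eq0 L)))/addrI/(mulfI (negbT (polyX_eq0 L))).
  by move/(congr1 (fun q : {poly L} => size q)); rewrite !size_polyXn => -[].
by exists (fun i => 'X^(k i)).
Qed.

(** The hypotheses describe an isotropic vector [w1 + w2 sqrt D]. At the point [c] the root of [D]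
    becomes [e] or [- e]. After removal of the common power of ['X], the specialized pair [u1], [u2]
    is nonzero, so one of the two signs yields a nonzero vector. *)
Lemma isotropic_specialize (K : fieldType) (L : field_extension K) (m N : nat)
    (A : 'M[K]_m) (D : {mpoly K[N]}) (w1 w2 : 'rV[{mpoly K[N]}]_m)
    (c : 'I_N -> L) (e : L) :
  2 != 0 :> L -> A^T = A -> e != 0 -> mmap (ext_map L) c D = e ^+ 2 ->
  row_mx w1 w2 != 0 ->
  let A' := map_mx (@mpolyC N K) A in
  bilin A' w1 w1 + D * bilin A' w2 w2 = 0 -> bilin A' w1 w2 = 0 ->
  isotropic (base_change L A).
Proof.
move=> two0 symA e0 De w0 A' q12 b12.
have /rV0Pn[j wj] := w0.
have [z zP] := mmap_poly_curve (ext_map L) c (fun=> 0) wj.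
set f := polyC \o ext_map L in zP; set g := (fun i => _) in zP.
pose h : {rmorphism {mpoly K[N]} -> {poly L}} := mmap f g.
pose AL : 'M[{poly L}]_m := map_mx polyC (base_change L A).
have hA : map_mx h A' = AL.
  by apply/matrixP => i k; rewrite !mxE /= mmapC.
have W0 : map_mx h (row_mx w1 w2) != 0.
  by apply: contraNneq zP => /rowP/(_ j)/eqP; rewrite !mxE.
have [k [W [WE W'0]]] := polyX_factor_row W0.
rewrite map_row_mx in WE.
have [W1E W2E] := row_mx_eq_scale WE.
set W1 := lsubmx W in W1E; set W2 := rsubmx W in W2E.
have Xk0 : 'X^k != 0 :> {poly L} by rewrite expf_neq0 ?polyX_eq0.
have bilinXk u v :
    'X^k * ('X^k * bilin AL u v) = bilin AL ('X^k *: u) ('X^k *: v).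
  by rewrite bilinZl bilinZr.
(* Both equations are quadratic in the pair, so the factor ['X^k] can be cancelled twice. *)
have B12 : bilin AL W1 W2 = 0.
  apply: (mulfI Xk0); apply: (mulfI Xk0); rewrite !mulr0.
  rewrite bilinXk -W1E -W2E -hA bilin_map.
  by rewrite [X in h X]b12 rmorph0.
have Q12 : bilin AL W1 W1 + h D * bilin AL W2 W2 = 0.
  apply: (mulfI Xk0); apply: (mulfI Xk0); rewrite !mulr0.
  have -> : forall x y : {poly L},
    'X^k * ('X^k * (x + h D * y)) =
    'X^k * ('X^k * x) + h D * ('X^k * ('X^k * y)).
    by move=> x y; ring.
  rewrite !bilinXk -W1E -W2E -hA !bilin_map -rmorphM -rmorphD.
  by rewrite [X in h X]q12 rmorph0.
pose ev : {rmorphism {poly L} -> L} := horner_eval 0.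
have evA : map_mx ev AL = base_change L A.
  by apply/matrixP => i k'; rewrite !mxE /= /horner_eval hornerC.
have evD : ev (h D) = e ^+ 2.
  rewrite /= [LHS](rmorph_mmap f ev g) -De.
  apply: eq_bigr => i _; rewrite /= /horner_eval hornerC; congr (_ * _).
  by apply: mmap1_eq => l; rewrite /g /= /horner_eval !hornerE.
pose u1 := map_mx ev W1; pose u2 := map_mx ev W2.
have b12' : bilin (base_change L A) u1 u2 = 0.
  by rewrite -evA bilin_map B12 rmorph0.
have q12' :
    qeval (base_change L A) u1 + e ^+ 2 * qeval (base_change L A) u2 = 0.
  by rewrite !qevalE -evD -evA !bilin_map -rmorphM -rmorphD Q12 rmorph0.
have symL : (base_change L A)^T = base_change L A.
  by rewrite /base_change map_trmx symA.
have qs (s : L) : s ^+ 2 = e ^+ 2 -> qeval (base_change L A) (u1 + s *: u2) = 0.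
  by move=> s2; rewrite qevalD // qevalZ bilinZr b12' !mulr0 addr0 s2.
(* Both signs cannot give zero: this would force [(2 * e) *: u2 = 0], hence [u2 = 0] and
   [u1 = 0]. *)
have [u0|u0] := eqVneq (u1 + e *: u2) 0; last first.
  by exists (u1 + e *: u2); rewrite qs.
exists (u1 + (- e) *: u2); split; last by rewrite qs // sqrrN.
apply: contraNneq W'0 => u0'.
rewrite -[W]hsubmxK map_row_mx row_mx_eq0 -/u1 -/u2.
have u20 : u2 = 0.
  have : (2 * e) *: u2 = (u1 + e *: u2) - (u1 + (- e) *: u2).
    rewrite opprD addrACA subrr add0r -scaleNr opprK -scalerDl.
    by congr (_ *: _); ring.
  rewrite u0 u0' subrr => /eqP.
  by rewrite scaler_eq0 mulf_eq0 (negPf two0) (negPf e0) => /eqP.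
by move: u0; rewrite u20 scaler0 addr0 => ->; rewrite !eqxx.
Qed.

(** * Parity of the order at 0 *)

(** Writing [w = 'X^k *: w'] with [w'] nonzero at 0, anisotropy makes the value at [w'] nonzero at
    0, so the order is exactly [2k]. *)
Lemma mup_bilin_even (F : fieldType) (m : nat) (A : 'M[F]_m)
    (w : 'rV[{poly F}]_m) :
  anisotropic A -> bilin (map_mx polyC A) w w != 0 ->
  ~~ odd (mup 0 (bilin (map_mx polyC A) w w)).
Proof.
move=> anisoA q0.
have w0 : w != 0 by apply: contraNneq q0 => ->; rewrite bilin0l.
have [k [w' [wE w'0]]] := polyX_factor_row w0.
move: q0; rewrite wE bilinZl bilinZr mulrA -exprD addnn => q0.
pose ev : {rmorphism {poly F} -> F} := horner_eval 0.
have evA : map_mx ev (map_mx polyC A) = A.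
  by apply/matrixP => i j; rewrite !mxE /= /horner_eval hornerC.
have nr : ~~ root (bilin (map_mx polyC A) w' w') 0.
  apply: contra w'0 => /eqP r0; apply/eqP/(anisotropic_qeval_eq0 anisoA).
  by rewrite qevalE -{1}evA; rewrite (bilin_map _ ev).
have -> : 'X^(k.*2) = ('X - 0%:P) ^+ k.*2 :> {poly F} by rewrite subr0.
by rewrite mupMl // mup_XsubCX eqxx odd_double.
Qed.

(** As [c] is isotropic, the value at [u] is ['X] times a polynomial whose constant term is twice
    the product of [c] with the tangent [y] at 0. *)
Lemma mup_bilin_isotropic (F : fieldType) (m : nat) (A : 'M[F]_m)
    (c : 'rV[F]_m) (y : 'rV[{poly F}]_m) :
  2 != 0 :> F -> A^T = A -> qeval A c = 0 ->
  bilin A c (map_mx (horner_eval 0) y) != 0 ->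
  let u := map_mx polyC c + 'X *: y in
  mup 0 (bilin (map_mx polyC A) u u) = 1%N.
Proof.
move=> two0 symA qc bcy u; set AX := map_mx polyC A.
have symX : AX^T = AX by rewrite /AX map_trmx symA.
have -> : bilin AX u u =
    ('X - 0%:P) ^+ 1 * (2 * bilin AX (map_mx polyC c) y + 'X * bilin AX y y).
  rewrite !bilinE (bilinC y) // [bilin AX (map_mx _ _) (map_mx _ _)]bilin_map.
  rewrite -qevalE qc subr0 expr1 /=.
  by ring.
rewrite mupMl ?mup_XsubCX ?eqxx // /root !hornerE.
rewrite mulf_neq0 //; move: bcy; congr (_ != 0).
pose ev : {rmorphism {poly F} -> F} := horner_eval 0.
have evA : map_mx ev AX = A.
  by apply/matrixP => i j; rewrite !mxE /= /horner_eval hornerC.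
have evc : map_mx ev (map_mx polyC c) = c.
  by apply/rowP => i; rewrite !mxE /= /horner_eval hornerC.
by rewrite -{1}evA -{1}evc (bilin_map _ ev).
Qed.

(** Induction on the generation of [x]: orders are even for values of [A], and evenness passes to
    products and inverses. The elements [q] and [p] are produced before [h] is quantified, so that
    [h] can later be chosen to keep them nonzero. *)
Lemma T_group_fraction_even_mup (R : idomainType) (L : fieldType) (m : nat)
    (A : 'M[R]_m) (B : 'M[L]_m) (x : {fraction R}) :
  anisotropic B -> T_group (map_mx (@FracField.tofrac R) A) x ->
  exists q p : R,
    [/\ q != 0, p != 0, FracField.tofrac q ^+ 2 * x = FracField.tofrac p
      & forall h : {rmorphism R -> {poly L}},
          map_mx h A = map_mx polyC B -> h p != 0 -> ~~ odd (mup 0 (h p))].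
Proof.
move=> anisoB.
elim=> {x} [x [x0 [v vx]]||x1 x2 _ [q1 [p1 [q10 p10 e1 h1]]] _
  [q2 [p2 [q20 p20 e2 h2]]]|x _ [q [p [q0 p0 e hP]]]].
- have [q [w [q0 wE]]] := clear_denominators v.
  have E := tofrac_bilin A wE wE; rewrite -qevalE vx in E.
  exists q, (bilin A w w); split=> //.
    by rewrite -tofrac_eq0 E mulf_neq0 // expf_neq0 // tofrac_eq0.
  by move=> h hA; rewrite -bilin_map hA; apply: mup_bilin_even.
- exists 1, 1; split; rewrite ?oner_eq0 ?rmorph1 ?expr1n ?mulr1 // => h hA _.
  by rewrite rmorph1 mupNroot // root1.
- exists (q1 * q2), (p1 * p2); split; rewrite ?mulf_neq0 //.
    by rewrite !tofracM exprMn mulrACA e1 e2.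
  move=> h hA; rewrite rmorphM mulf_eq0 negb_or => /andP[hp1 hp2].
  by rewrite mupM // oddD (negPf (h1 h hA hp1)) (negPf (h2 h hA hp2)).
- have tp0 : FracField.tofrac p != 0 by rewrite tofrac_eq0.
  have x0 : x != 0 by apply: contraNneq tp0 => x0; rewrite -e x0 mulr0.
  (* From [q ^+ 2 * x = p] follows [p ^+ 2 * x^-1 = q ^+ 2 * p], in which the square does not affect
     parity. *)
  exists p, (q ^+ 2 * p); split=> //; first by rewrite mulf_neq0 ?expf_neq0.
    by rewrite tofracM tofracXn expr2 -{1}e mulrAC mulfK.
  move=> h hA; rewrite rmorphM rmorphXn mulf_eq0 negb_or => /andP[hq hp].
  rewrite mupM // oddD (negPf (hP h hA hp)) addbF expr2.
  move: hq; rewrite sqrf_eq0 => hq.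
  by rewrite mupM // addnn odd_double.
Qed.

Lemma T_group_tofrac_even_mup (R : idomainType) (L : fieldType) (m : nat)
    (A : 'M[R]_m) (B : 'M[L]_m) (y : R) :
  anisotropic B ->
  T_group (map_mx (@FracField.tofrac R) A) (FracField.tofrac y) ->
  exists2 q : R, q != 0
    & forall h : {rmorphism R -> {poly L}}, map_mx h A = map_mx polyC B ->
        h q != 0 -> h y != 0 -> ~~ odd (mup 0 (h y)).
Proof.
move=> anisoB /(T_group_fraction_even_mup anisoB)[q [p [q0 _ e hP]]].
exists q => // h hA hq hy.
have pE : q ^+ 2 * y = p.
  by apply/eqP; rewrite -tofrac_eq tofracM tofracXn e.
have := hP h hA; rewrite -pE rmorphM rmorphXn mulf_neq0 ?expf_neq0 //.
by rewrite expr2 !mupM ?mulf_neq0 // addnn oddD odd_double => ->.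
Qed.

Lemma generic_valueE (K : fieldType) (n : nat) (A : 'M[K]_n) :
  generic_value A = FracField.tofrac
    (bilin (map_mx (@mpolyC n K) A) (\row_i 'X_i) (\row_i 'X_i)).
Proof.
rewrite /generic_value qevalE base_change_ratfun.
have -> : \row_i ratfun_X K i =
    map_mx (@FracField.tofrac {mpoly K[n]}) (\row_i 'X_i).
  by apply/rowP => i; rewrite !mxE.
exact: bilin_map.
Qed.

Lemma isotropic_of_T_group (K : fieldType) (L : field_extension K) (m n : nat)
    (A : 'M[K]_m) (B : 'M[K]_n) (a : K) :
  2 != 0 :> L -> quadratic_form B -> a != 0 ->
  T_group (base_change (ratfun K n) A)
    (ext_map (ratfun K n) a * generic_value B) ->
  isotropic (base_change L B) -> isotropic (base_change L A).
Proof.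
move=> two0 qB a0 Ta [c [c0 qc]]; apply: NNPP => anisoA.
have qBL : quadratic_form (base_change L B) by apply: map_quadratic_form.
have [y bcy] : exists y : 'rV[L]_n, bilin (base_change L B) c y != 0.
  by have [i bi] := qform_bilin_neq0 qBL c0; exists (delta_mx 0 i).
pose G := bilin (map_mx (@mpolyC n K) B) (\row_j 'X_j) (\row_j 'X_j).
have [q q0 hP] : exists2 q : {mpoly K[n]}, q != 0
    & forall h : {rmorphism {mpoly K[n]} -> {poly L}},
        map_mx h (map_mx (@mpolyC n K) A) = map_mx polyC (base_change L A) ->
        h q != 0 -> h (a%:MP * G) != 0 -> ~~ odd (mup 0 (h (a%:MP * G))).
  apply: (T_group_tofrac_even_mup anisoA).
  by rewrite tofracM -base_change_ratfun -generic_valueE.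
(* The point [c] and the tangent [y] are prescribed; the higher-order terms keep [q] nonzero along
   the curve. *)
have [z zP] := mmap_poly_curve (ext_map L) (c 0) (y 0) q0.
set f := polyC \o ext_map L in zP; set g := (fun i => _) in zP.
pose h : {rmorphism {mpoly K[n]} -> {poly L}} := mmap f g.
have hC k : h k%:MP = (ext_map L k)%:P by rewrite /= mmapC.
pose Y : 'rV[{poly L}]_n := map_mx polyC y + 'X *: \row_j z j.
have hM k (C : 'M[K]_k) :
    map_mx h (map_mx (@mpolyC n K) C) = map_mx polyC (base_change L C).
  by apply/matrixP => i j; rewrite !mxE hC.
have hG : mup 0 (h G) = 1%N.
  rewrite -bilin_map hM.
  have -> : map_mx h (\row_j 'X_j) = map_mx polyC c + 'X *: Y.
    by apply/rowP => j; rewrite !mxE /= mmapX mmap1U.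
  apply: mup_bilin_isotropic => //; first exact: qBL.1.
  suff -> : map_mx (horner_eval 0) Y = y by [].
  by apply/rowP => j; rewrite !mxE /= /horner_eval !hornerE.
(* [mup] is bounded by the size of the polynomial, so an order equal to 1 excludes the zero
   polynomial. *)
have hG0 : h G != 0.
  have : (mup 0 (h G) < (size (h G)).+1)%N := ltn_ord _.
  by rewrite hG ltnS size_poly_gt0.
have ha0 : (ext_map L a)%:P != 0 by rewrite polyC_eq0 fmorph_eq0.
have := hP h (hM _ A) zP.
rewrite rmorphM hC mulf_neq0 // mupM // hG mupNroot => [/(_ isT)//|].
by rewrite rootC fmorph_eq0.
Qed.

(** * Diagonal forms and the function field *)

Lemma symmetric_qeval_inj (F : fieldType) (n : nat) (A B : 'M[F]_n) :
  2 != 0 :> F -> A^T = A -> B^T = B -> qeval A =1 qeval B -> A = B.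
Proof.
move=> two0 symA symB AB; apply/matrixP => i j.
have E (C : 'M[F]_n) : C i j = bilin C (delta_mx 0 i) (delta_mx 0 j).
  by rewrite bilin_delta -rowE mxE.
rewrite !E; apply: (mulfI two0).
have := AB (delta_mx 0 i + delta_mx 0 j); rewrite !qevalD // !AB.
by move/addrI.
Qed.

(** An identity of matrices, obtained by polarization, passes to every extension; an equality of
    values on vectors over [K] alone would not. *)
Lemma isometric_diagE (K : fieldType) (n : nat) (A : 'M[K]_n) (b : 'rV[K]_n) :
  2 != 0 :> K -> A^T = A -> isometric A (diag_mx b) ->
  exists2 P, P \in unitmx & A = P *m diag_mx b *m P^T.
Proof.
move=> two0 symA [P [uP AP]]; exists P => //.
apply: symmetric_qeval_inj => // [|v].
  by rewrite !trmx_mul trmxK tr_diag_mx mulmxA.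
by rewrite AP /qeval trmx_mul !mulmxA.
Qed.

Lemma isotropic_congr (F : fieldType) (n : nat) (A P : 'M[F]_n) :
  P \in unitmx -> isotropic (P *m A *m P^T) <-> isotropic A.
Proof.
move=> uP; split=> -[v [v0 qv]].
  exists (v *m P); split.
    by apply: contraNneq v0 => vP; rewrite -(mulmxK uP v) vP mul0mx.
  by rewrite -qv /qeval trmx_mul !mulmxA.
exists (v *m invmx P); split.
  by apply: contraNneq v0 => vP; rewrite -(mulmxKV uP v) vP mul0mx.
rewrite -qv /qeval !mulmxA mulmxKV //; congr (fun_of_matrix _ _ _).
by rewrite -mulmxA -trmx_mul mulmxKV.
Qed.

Lemma qeval_diag (F : fieldType) (n : nat) (b x : 'rV[F]_n) :
  qeval (diag_mx b) x = \sum_i b 0 i * x 0 i ^+ 2.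
Proof.
rewrite /qeval mxE; apply: eq_bigr => i _.
by rewrite mul_mx_diag !mxE mulrAC mulrC expr2.
Qed.

(** If [x] has first coordinate 0 and [x 0 j] is nonzero, then [u = e_0 + e_j] is not orthogonal to
    [x]. A suitable multiple of [x] added to [u] makes it isotropic and leaves its first coordinate
    equal to 1. *)
Lemma isotropic_diag_head (F : fieldType) (n : nat) (b : 'rV[F]_n.+1) :
  2 != 0 :> F -> (forall i, b 0 i != 0) -> isotropic (diag_mx b) ->
  exists2 x : 'rV[F]_n.+1, x 0 ord0 != 0 & qeval (diag_mx b) x = 0.
Proof.
move=> two0 b0 [x [x0 qx]].
have [xh|] := eqVneq (x 0 ord0) 0; last by exists x.
have /rV0Pn[j xj] := x0.
have j0 : ord0 != j by apply: contraNneq xj => <-; rewrite xh.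
have symD : (diag_mx b)^T = diag_mx b by rewrite tr_diag_mx.
pose u : 'rV[F]_n.+1 := delta_mx 0 ord0 + delta_mx 0 j.
have bxu : bilin (diag_mx b) x u = x 0 j * b 0 j.
  by rewrite bilinDr !bilin_delta mul_mx_diag !mxE xh mul0r add0r.
exists (u + (- qeval (diag_mx b) u / (2 * (x 0 j * b 0 j))) *: x).
  by rewrite !mxE !eqxx (negPf j0) xh mulr0 !addr0 oner_eq0.
rewrite qevalD // qevalZ qx bilinZr bilinC // bxu.
by field; rewrite two0 xj b0.
Qed.

Lemma base_change_diag (K : fieldType) (F : field_extension K) (n : nat)
    (b : 'rV[K]_n) :
  base_change F (diag_mx b) = diag_mx (map_mx (ext_map F) b).
Proof. exact: map_diag_mx. Qed.

Lemma ext_two_neq0 (K : fieldType) (F : field_extension K) :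
  2 != 0 :> K -> 2 != 0 :> F.
Proof. by rewrite -(fmorph_eq0 (ext_map F)) rmorph_nat. Qed.

Lemma isotropic_dim_gt0 (F : fieldType) (n : nat) (A : 'M[F]_n) :
  isotropic A -> (0 < n)%N.
Proof. by case: n A => // A [v [/rV0Pn[[]]]]. Qed.

(** The isotropic vector is the generic point: the square root [s] of the radicand followed by the
    variables. *)
Lemma isotropic_function_field (K : fieldType) (n : nat) (b : 'rV[K]_n.+2) :
  b 0 ord0 != 0 -> isotropic (base_change (function_field b) (diag_mx b)).
Proof.
move=> b0; have [s [s2 _]] := sqrt_extensionP (function_field_radicand b).
rewrite /function_field; move: (sqrt_extension _) s s2 => L s s2.
rewrite base_change_comp !base_change_diag.
pose f := ext_map L; rewrite -/f in s2 *.
pose x : 'rV[L]_n.+2 :=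
  \row_i if unlift ord0 i is Some j then f (ratfun_X K j) else s.
exists x; split.
  apply/eqP => /rowP/(_ (lift ord0 ord0))/eqP; rewrite !mxE liftK fmorph_eq0.
  rewrite /ratfun_X tofrac_eq0 => /eqP/(congr1 (mcoeff U_(ord0))).
  by rewrite mcoeffX eqxx mcoeff0 => /eqP; rewrite oner_eq0.
rewrite qeval_diag big_ord_recl !mxE unlift_none s2 -rmorphM.
set c := ext_map _ (b 0 ord0); have c0 : c != 0 by rewrite fmorph_eq0.
rewrite /function_field_radicand mulrA mulrN mulfV // mulN1r rmorphN rmorph_sum.
apply/eqP; rewrite addrC subr_eq0; apply/eqP; apply: eq_bigr => i _.
by rewrite !mxE liftK -rmorphXn -rmorphM.
Qed.

(** An isotropic vector over the function field has the form [w1 + w2 sqrt D] with [w1], [w2]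
    polynomial after clearing denominators. It is specialized at the tail of an isotropic vector [x]
    of [diag_mx b] over [L], where [D] takes the value [x 0 ord0 ^+ 2]; hence the need for a nonzero
    first coordinate. *)
Lemma isotropic_of_function_field (K : fieldType) (m n : nat) (A : 'M[K]_m)
    (b : 'rV[K]_n.+2) (L : field_extension K) :
  2 != 0 :> K -> A^T = A -> (forall i, b 0 i != 0) ->
  isotropic (base_change (function_field b) A) ->
  isotropic (base_change L (diag_mx b)) -> isotropic (base_change L A).
Proof.
move=> two0 symA b0; rewrite base_change_comp base_change_diag => isoA isoL.
have symR : (base_change (ratfun K n.+1) A)^T = base_change (ratfun K n.+1) A.
  by rewrite /base_change map_trmx symA.
have [v1 [v2 [v0 qv bv]]] :=
  isotropic_sqrt_extension (ext_two_neq0 _ two0) symR isoA.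
have [|x x0 qx] := isotropic_diag_head (ext_two_neq0 L two0) _ isoL.
  by move=> i; rewrite mxE fmorph_eq0.
pose D : {mpoly K[n.+1]} := - (b 0 ord0)^-1%:MP *
  \sum_(i < n.+1) (b 0 (lift ord0 i))%:MP * 'X_i ^+ 2.
have DE : FracField.tofrac D = function_field_radicand b.
  rewrite /D /function_field_radicand rmorphM rmorphN rmorph_sum /=.
  congr (- _ * _); last by apply: eq_bigr => i _; rewrite rmorphM rmorphXn.
  exact: (fmorphV (ext_map (ratfun K n.+1))).
rewrite base_change_ratfun -DE in qv bv.
have [w1 [w2 [w0 qw bw]]] := clear_denominators_isotropic v0 qv bv.
apply: (@isotropic_specialize _ L m _ A D w1 w2 (fun i => x 0 (lift ord0 i)) _
  (ext_two_neq0 L two0) symA x0 _ w0 qw bw).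
set c := fun i => _; have mC k : mmap (ext_map L) c k%:MP = ext_map L k.
  exact: mmapC.
rewrite /D rmorphM rmorphN rmorph_sum /= mC fmorphV.
have c0 : ext_map L (b 0 ord0) != 0 by rewrite fmorph_eq0.
apply: (mulfI c0); rewrite mulrA mulrN mulfV // mulN1r; apply/eqP.
rewrite eq_sym -subr_eq0 opprK -[X in _ == X]qx qeval_diag.
rewrite [X in _ == X]big_ord_recl mxE.
apply/eqP; congr (_ + _); apply: eq_bigr => i _.
by rewrite rmorphM rmorphXn /= mC mmapX mmap1U mxE.
Qed.

(** * Generated subgroups and represented values *)

Lemma gen_subgroup_le (F : fieldType) (S S' : F -> Prop) :
  (forall x, S x -> gen_subgroup S' x) ->
  forall x, gen_subgroup S x -> gen_subgroup S' x.
Proof.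
move=> SS' x; elim=> {x} [x /SS'//||x y _ Sx _ Sy|x _ Sx].
- exact: gen_subgroup1.
- exact: gen_subgroupM.
- exact: gen_subgroupV.
Qed.

Lemma N_group_sub_T_group (F : fieldType) (n : nat) (A : 'M[F]_n) (x : F) :
  N_group A x -> T_group A x.
Proof.
apply: gen_subgroup_le => _ [y [z [Ay Az ->]]].
by apply: gen_subgroupM; apply: gen_subgroup_mem.
Qed.

Lemma repr_set_base_change (K : fieldType) (F : field_extension K) (n : nat)
    (A : 'M[K]_n) (a : K) :
  repr_set A a -> repr_set (base_change F A) (ext_map F a).
Proof.
move=> [a0 [v vE]]; split; first by rewrite fmorph_eq0.
by exists (map_mx (ext_map F) v); rewrite qeval_base_change vE.
Qed.

Lemma qeval_base_changeZ (K : fieldType) (F : field_extension K) (n : nat)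
    (A : 'M[K]_n) (a : K) (v : 'rV[F]_n) :
  qeval (base_change F (a *: A)) v = ext_map F a * qeval (base_change F A) v.
Proof. by rewrite /base_change map_mxZ /qeval -scalemxAr -scalemxAl mxE. Qed.

Lemma repr_set_base_changeZ (K : fieldType) (F : field_extension K) (n : nat)
    (A : 'M[K]_n) (a : K) (x : F) :
  a != 0 -> repr_set (base_change F A) x ->
  repr_set (base_change F (a *: A)) (ext_map F a * x).
Proof.
move=> a0 [x0 [v vx]]; split; first by rewrite mulf_neq0 // fmorph_eq0.
by exists v; rewrite qeval_base_changeZ vx.
Qed.

(** Provides an element of [repr_set A], so that conditions quantified over represented [a] can be
    instantiated. *)
Lemma anisotropic_repr (K : fieldType) (n : nat) (A : 'M[K]_n.+1) :
  anisotropic A -> repr_set A (qeval A (const_mx 1)).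
Proof.
move=> anisoA; split; last by exists (const_mx 1).
apply/eqP => /(anisotropic_qeval_eq0 anisoA)/rowP/(_ ord0)/eqP.
by rewrite !mxE oner_eq0.
Qed.

(** The generic value is nonzero because it specializes at the all-ones vector to a nonzero value of
    [A]. *)
Lemma generic_value_repr (K : fieldType) (n : nat) (A : 'M[K]_n.+1) :
  anisotropic A -> repr_set (base_change (ratfun K n.+1) A) (generic_value A).
Proof.
move=> anisoA; split; last by exists (\row_i ratfun_X K i).
have [q0 _] := anisotropic_repr anisoA.
rewrite generic_valueE tofrac_eq0; apply: contraNneq q0 => G0.
pose ev : {rmorphism {mpoly K[n.+1]} -> K} := meval (fun=> 1).
have <- : map_mx ev (map_mx (@mpolyC n.+1 K) A) = A.
  by apply/matrixP => i j; rewrite !mxE /= mevalC.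
have <- : map_mx ev (\row_i 'X_i) = const_mx 1.
  by apply/rowP => i; rewrite !mxE /= mevalXU.
by rewrite qevalE (bilin_map _ ev) G0 rmorph0.
Qed.


Theorem theorem3p7 (K : fieldType) (charK : 2%N \notin [pchar K])
  (m n : nat) (phi : 'M[K]_m) (psi : 'M[K]_n.+2)
  (qphi : quadratic_form phi) (qpsi : quadratic_form psi)
  (aphi : anisotropic phi) (apsi : anisotropic psi)
  (b : 'rV[K]_n.+2) (psi_diag : isometric psi (diag_mx b)) :
  [<->
    (* 1 *)
    isotropic (base_change (function_field b) phi);
    (* 2 *)
    forall (F : field_extension K) (x : F),
      repr_prod (base_change F psi) x -> repr_prod (base_change F phi) x;
    (* 3 *)
    forall a : K, repr_set psi a ->
      repr_prod (base_change (ratfun K n.+2) phi)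
        (ext_map (ratfun K n.+2) a * generic_value psi);
    (* 4 *)
    forall (F : field_extension K) (x : F),
      N_group (base_change F psi) x -> N_group (base_change F phi) x;
    (* 5 *)
    forall a : K, repr_set psi a ->
      N_group (base_change (ratfun K n.+2) phi)
        (ext_map (ratfun K n.+2) a * generic_value psi);
    (* 6 *)
    forall (F : field_extension K) (a : K), repr_set psi a -> forall x : F,
      T_group (base_change F (a *: psi)) x -> T_group (base_change F phi) x;
    (* 7 *)
    forall a : K, repr_set psi a ->
      T_group (base_change (ratfun K n.+2) phi)
        (ext_map (ratfun K n.+2) a * generic_value psi)
  ].
Proof.
have two0 : 2 != 0 :> K by move: charK; rewrite inE.
have [symphi sympsi] := (qphi.1, qpsi.1).
have [P uP psiE] := isometric_diagE two0 sympsi psi_diag.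
have b0 i : b 0 i != 0.
  have := qpsi.2; rewrite psiE !unitmx_mul => /andP[/andP[_ +] _].
  rewrite unitmxE det_diag unitfE => /prodf_neq0; exact.
have iso_psi (L : field_extension K) :
    isotropic (base_change L psi) <-> isotropic (base_change L (diag_mx b)).
  rewrite psiE {1}/base_change !map_mxM -map_trmx.
  by apply: isotropic_congr; rewrite map_unitmx.
have P7_1 : (forall a : K, repr_set psi a ->
      T_group (base_change (ratfun K n.+2) phi)
        (ext_map (ratfun K n.+2) a * generic_value psi)) ->
    isotropic (base_change (function_field b) phi).
  move=> /(_ _ (anisotropic_repr apsi)) Tpsi.
  apply: (isotropic_of_T_group _ qpsi (anisotropic_repr apsi).1 Tpsi).
    exact: ext_two_neq0.
  by apply/iso_psi; apply: isotropic_function_field.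
have P1_2 : isotropic (base_change (function_field b) phi) ->
    forall (F : field_extension K) (x : F),
      repr_prod (base_change F psi) x -> repr_prod (base_change F phi) x.
  move=> iso1 F; apply: repr_prod_binary.
  - exact: ext_two_neq0.
  - exact: map_quadratic_form.
  - exact: isotropic_dim_gt0 iso1.
  - by rewrite /base_change map_trmx sympsi.
  (* [F(sqrt d)] is regarded as an extension of [K], so that isotropy can be transferred from [psi]
     to [phi] over it. *)
  move=> d isod; pose L := comp_extension (sqrt_extension d).
  have /iso_psi isoL : isotropic (base_change L psi).
    by rewrite base_change_comp.
  have := isotropic_of_function_field two0 symphi b0 iso1 isoL.
  by rewrite base_change_comp.
have P2_4 : (forall (F : field_extension K) (x : F),
      repr_prod (base_change F psi) x -> repr_prod (base_change F phi) x) ->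
    forall (F : field_extension K) (x : F),
      N_group (base_change F psi) x -> N_group (base_change F phi) x.
  by move=> P2 F; apply: gen_subgroup_le => x /P2; apply: gen_subgroup_mem.
have prod_psi (a : K) : repr_set psi a ->
    repr_prod (base_change (ratfun K n.+2) psi)
      (ext_map (ratfun K n.+2) a * generic_value psi).
  move=> psi_a; exists (ext_map (ratfun K n.+2) a), (generic_value psi).
  split=> //; first exact: repr_set_base_change.
  exact: generic_value_repr.
(* Conditions (3) and (5) concern [K(X)] only; to reach all extensions in (4) and (6), each is first
   weakened to (7) and then passes through (1) and (2). *)
tfae.
- exact: P1_2.
- by move=> P2 a /prod_psi/P2.
- move=> P3; apply/P2_4/P1_2/P7_1 => a /P3 phi_a.
  by apply/N_group_sub_T_group/gen_subgroup_mem.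
- by move=> P4 a /prod_psi psi_a; apply/P4/gen_subgroup_mem.
- move=> P5 F a psi_a; have P2 : forall (F : field_extension K) (x : F),
      repr_prod (base_change F psi) x -> repr_prod (base_change F phi) x.
    by apply/P1_2/P7_1 => c /P5/N_group_sub_T_group.
  apply: gen_subgroup_le => x [x0 [v vx]].
  have xE : x = ext_map F a * qeval (base_change F psi) v.
    by rewrite -vx qeval_base_changeZ.
  (* A value of [a *: psi] is a product of two values of [psi], one of them [a], so (2) applies to
     it. *)
  apply/N_group_sub_T_group/gen_subgroup_mem/P2.
  exists (ext_map F a), (qeval (base_change F psi) v); split=> //.
    exact: repr_set_base_change.
  split; last by exists v.
  by apply: contraNneq x0 => q0; rewrite xE q0 mulr0.
- move=> P6 a psi_a; apply: (P6 _ a psi_a); apply: gen_subgroup_mem.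
  exact: (repr_set_base_changeZ psi_a.1 (generic_value_repr apsi)).
- exact: P7_1.
Qed.
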